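(* Let $(\mathcal{S},\mathcal{T})$ and $(\mathcal{S}',\mathcal{T}')$ be media and let $(\alpha,\beta)$ be an embedding of $(\mathcal{S},\mathcal{T})$ into $(\mathcal{S}',\mathcal{T}')$. Then the reduction $(\alpha(\mathcal{S}),\mathcal{T}'_{\alpha(\mathcal{S})})$ of $(\mathcal{S}',\mathcal{T}')$ to $\alpha(\mathcal{S})$ is isomorphic to $(\mathcal{S},\mathcal{T})$.
   Context: A token system is a pair $(\mathcal{S},\mathcal{T})$ where $\mathcal{S}$ is a set of states with $|\mathcal{S}|\ge 2$ and $\mathcal{T}$ is a nonempty set of tokens, each token being a map $\tau:\mathcal{S}\to\mathcal{S}$, $S\mapsto S\tau$, different from the identity. A token $\tilde\tau$ is a reverse of $\tau$ if for all distinct $S,V$: $S\tau=V\iff V\tilde\tau=S$. A message is a finite string $\mathbf{m}=\tau_1\cdots\tau_n$ of tokens acting by $S\mathbf{m}=(\cdots(S\tau_1)\cdots)\tau_n$ (empty message = identity), producing states $S_0=S$, $S_i=S\tau_1\cdots\tau_i$. It is consistent if it does not contain both a token and its reverse; vacuous if $\{1,\dots,n\}$ can be partitioned into pairs $\{i,j\}$ with $\tau_i,\tau_j$ mutual reverses; stepwise effective for $S$ if $S_k\neq S_{k-1}$ for all $k$; concise for $S$ if stepwise effective for $S$, consistent, and no token occurs twice; closed for $S$ if stepwise effective for $S$ and $S\mathbf{m}=S$. A medium is a token system with [M1] for any distinct states $S,V$ some message concise for $S$ transforms $S$ into $V$, and [M2] every message closed for some state is vacuous. An embedding of a token system $(\mathcal{S},\mathcal{T})$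 into a token system $(\mathcal{S}',\mathcal{T}')$ is a pair of injective maps $\alpha:\mathcal{S}\to\mathcal{S}'$, $\beta:\mathcal{T}\to\mathcal{T}'$ such that $S\tau=T\iff\alpha(S)\beta(\tau)=\alpha(T)$ for all $S,T\in\mathcal{S}$, $\tau\in\mathcal{T}$; it is an isomorphism if $\alpha$ and $\beta$ are bijections, and the systems are then isomorphic. For a token system $(\mathcal{S}',\mathcal{T}')$, a nonempty $\mathcal{Q}\subseteq\mathcal{S}'$ and $\tau\in\mathcal{T}'$, the reduction $\tau_{\mathcal{Q}}:\mathcal{Q}\to\mathcal{Q}$ is $S\tau_{\mathcal{Q}}=S\tau$ if $S\tau\in\mathcal{Q}$ and $S\tau_{\mathcal{Q}}=S$ otherwise. $\mathcal{T}'_{\mathcal{Q}}$ is the set of all distinct maps $\tau_{\mathcal{Q}}$, $\tau\in\mathcal{T}'$, other than the identity on $\mathcal{Q}$, and $(\mathcal{Q},\mathcal{T}'_{\mathcal{Q}})$ is the reduction of $(\mathcal{S}',\mathcal{T}')$ to $\mathcal{Q}$. *)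

(* Defs.v *)
From mathcomp Require Import all_boot.
From mathcomp Require Import boolp classical_sets.

Set Implicit Arguments.
Unset Strict Implicit.
Unset Printing Implicit Defensive.

Local Open Scope classical_set_scope.

(* Only the carrier and the set of maps: the axioms are in [token_system], so
   that a reduction can be formed before it is known to satisfy them. *)
Record system := System {
  state : Type;
  tokens : set (state -> state) }.
Arguments tokens : clear implicits.

Definition token_system (A : system) : Prop :=
  [/\ exists S V : state A, S <> V,
      tokens A !=set0
    & forall tau, tokens A tau -> tau <> id].

Section Messages.
Variable A : system.

Definition token := set_type (tokens A).

Definition reverse (tau tau' : token) : Prop :=
  forall S V : state A, S <> V -> (val tau S = V <-> val tau' V = S).

Definition message := seq token.

Definition nth_token (m : message) (i : 'I_(size m)) : token :=
  tnth (in_tuple m) i.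

Definition act (S : state A) (m : message) : state A :=
  foldl (fun V (tau : token) => val tau V) S m.

(* [state_at S m i] is S_i in the sequence S = S_0, S_1, ..., S_n produced
   by m from S. *)
Definition state_at (S : state A) (m : message) (i : nat) : state A :=
  act S (take i m).

Definition consistent (m : message) : Prop :=
  forall i j : 'I_(size m), ~ reverse (nth_token i) (nth_token j).

Definition vacuous (m : message) : Prop :=
  exists P : {set {set 'I_(size m)}},
    finset.partition P [set: 'I_(size m)]%SET /\
    forall B, B \in P -> exists i j : 'I_(size m),
      [/\ i <> j, B = [set i; j]%SET,
          reverse (nth_token i) (nth_token j)
        & reverse (nth_token j) (nth_token i)].

Definition stepwise_effective (S : state A) (m : message) : Prop :=
  forall k, k < size m -> state_at S m k.+1 <> state_at S m k.

Definition concise (S : state A) (m : message) : Prop :=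
  [/\ stepwise_effective S m, consistent m & injective (@nth_token m)].

Definition closed (S : state A) (m : message) : Prop :=
  stepwise_effective S m /\ act S m = S.

End Messages.

Definition medium (A : system) : Prop :=
  [/\ token_system A,
      forall S V : state A, S <> V ->
        exists m : message A, concise S m /\ act S m = V
    & forall m : message A, (exists S, closed S m) -> vacuous m].

Definition embedding (A B : system)
    (alpha : state A -> state B) (beta : token A -> token B) : Prop :=
  [/\ token_system A, token_system B, injective alpha, injective beta
    & forall (S T : state A) (tau : token A),
        val tau S = T <-> val (beta tau) (alpha S) = alpha T].

Definition isomorphic (A B : system) : Prop :=
  exists (alpha : state A -> state B) (beta : token A -> token B),
    [/\ embedding alpha beta, bijective alpha & bijective beta].

(* [insubd S V] is V, seen as an element of Q, if V is in Q, and S otherwise. *)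
Definition reduce (B : system) (Q : set (state B)) (tau : state B -> state B)
    (S : set_type Q) : set_type Q :=
  insubd S (tau (val S)).

Definition reduction (B : system) (Q : set (state B)) : system :=
  @System (set_type Q)
    [set sigma | (exists2 tau, tokens B tau & sigma = reduce tau (Q := Q)) /\
                 sigma <> id].

(* Main.v *)
Require Import Defs.
From mathcomp Require Import all_boot.
From mathcomp Require Import boolp classical_sets.

(** If a token [tau'] of the big medium moves [alpha S] to [alpha T], take a
concise message [m] of the small medium from [T] to [S]. Then [tau'] followed by
the image of [m] is closed, hence vacuous; but the image of [m] is still
consistent, so [tau'] is its only possible partner and [m] is a single token
whose image is a reverse of [tau']. Applying this again to that token produces
a token of the small medium whose image agrees with [tau']. Thus the
nonidentity reductions are exactly the conjugates by [alpha] of the tokens of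
the small medium. *)

Set Implicit Arguments.
Unset Strict Implicit.
Unset Printing Implicit Defensive.

Local Open Scope classical_set_scope.

Lemma bijective_inj_surj (X Y : Type) (f : X -> Y) :
  injective f -> (forall y, exists x, f x = y) -> bijective f.
Proof.
move=> f_inj /choice[g gK]; exists g => // x.
by apply: f_inj; rewrite gK.
Qed.

(** * Messages, consistency and vacuity in one token system *)

Section TokenSystems.
Variable A : system.
Implicit Types (S T : state A) (tau : token A) (m : message A).

Lemma token_neq_id tau : token_system A -> val tau <> id.
Proof. by case=> _ _ A_id; apply: A_id; exact: set_mem (valP tau). Qed.

Lemma stepwise_effective_cons S tau m :
  stepwise_effective S (tau :: m) <->
  val tau S <> S /\ stepwise_effective (val tau S) m.
Proof.
split=> [eff | [tauS eff] [|k] //].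
- split; first by have := eff 0 isT; rewrite /state_at /= take0.
  by move=> k k_lt; exact: (eff k.+1).
- by rewrite /state_at /= take0.
- exact: eff.
Qed.

Lemma consistentP (tau0 : token A) m :
  consistent m <-> forall i j, i < size m -> j < size m ->
    ~ reverse (nth tau0 m i) (nth tau0 m j).
Proof.
split=> [m_cons i j i_lt j_lt | m_cons i j].
  have := m_cons (Ordinal i_lt) (Ordinal j_lt).
  by rewrite /nth_token !(tnth_nth tau0).
by rewrite /nth_token !(tnth_nth tau0); apply: m_cons.
Qed.

(** Every block has two elements, so each index has a partner in its block; disjointness of the
    blocks makes the partner map injective. *)
Lemma vacuous_pairing m : vacuous m ->
  exists2 p : 'I_(size m) -> 'I_(size m), injective p &
    forall i, [/\ p i <> i, reverse (nth_token i) (nth_token (p i))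
                & reverse (nth_token (p i)) (nth_token i)].
Proof.
case=> P [partP pairP].
have : forall i, exists j, [/\ j <> i, [set i; j]%SET \in P,
    reverse (nth_token i) (nth_token j) & reverse (nth_token j) (nth_token i)].
  move=> i; have : i \in finset.cover P.
    by rewrite (finset.cover_partition partP) inE.
  case/finset.bigcupP => B B_in.
  have [a [b [neq_ab B_eq rev_ab rev_ba]]] := pairP B B_in.
  rewrite B_eq in B_in *; rewrite !inE => /orP[] /eqP ->.
    by exists b; split=> // /esym.
  by exists a; rewrite finset.setUC.
case/choice=> p pP; exists p; last by move=> i; have [] := pP i.
move=> i j eq_p; have [neq_i i_in _ _] := pP i; have [_ j_in _ _] := pP j.
have trivP : finset.trivIset P by case/and3P: partP.
(* Both blocks contain the common partner, so they coincide. *)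
have eq_B : [set i; p i]%SET = [set j; p j]%SET.
  rewrite -(finset.def_pblock trivP i_in (finset.set22 i (p i))).
  by rewrite eq_p (finset.def_pblock trivP j_in (finset.set22 j (p j))).
have := finset.set21 i (p i); rewrite eq_B !inE -eq_p => /orP[] /eqP // i_eq.
by case: neq_i.
Qed.

(* The partner of a letter of [m] must be [tau], which has only one partner. *)
Lemma vacuous_cons_consistent tau m : vacuous (tau :: m) -> consistent m ->
  exists2 rho, m = [:: rho] & reverse tau rho /\ reverse rho tau.
Proof.
move=> /vacuous_pairing[p p_inj pP] /(consistentP tau) m_cons.
have p0 (i : 'I_(size (tau :: m))) : i != ord0 -> p i = ord0.
  have [_ + _] := pP i; rewrite /nth_token !(tnth_nth tau) /=.
  case: i => -[|i] //= i_lt; set j := p _.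
  case: j => -[|j] //= j_lt rev_ij _; first exact: val_inj.
  by case: (m_cons i j).
(* With [m] empty, index 0 would be its own partner; with two or more letters, indices 1 and 2 would
   share the partner 0. *)
case: m => [|rho [|rho' m]] in p p_inj pP m_cons p0 *.
- by have [neq _ _] := pP ord0; case: neq; rewrite [LHS]ord1.
- exists rho => //; pose i1 := Ordinal (isT : 1 < 2).
  have [_ rev_rho rev_tau] := pP i1; split.
    by move: rev_tau; rewrite (p0 i1) // /nth_token !(tnth_nth tau).
  by move: rev_rho; rewrite (p0 i1) // /nth_token !(tnth_nth tau).
- pose i1 := Ordinal (isT : 1 < (size m).+3).
  pose i2 := Ordinal (isT : 2 < (size m).+3).
  have /p_inj // : p i1 = p i2 by rewrite !p0.
Qed.

End TokenSystems.

(** * Inverting an isomorphism *)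

Lemma embedding_inverse (A B : system) (alpha : state A -> state B)
    (beta : token A -> token B) alpha' beta' :
  cancel alpha alpha' -> cancel alpha' alpha ->
  cancel beta beta' -> cancel beta' beta ->
  embedding alpha beta -> embedding alpha' beta'.
Proof.
move=> aK a'K bK b'K [A_sys B_sys _ _ ab].
split=> //; [exact: can_inj a'K | exact: can_inj b'K|].
by move=> S T tau; rewrite ab b'K !a'K.
Qed.

Lemma isomorphic_sym (A B : system) : isomorphic A B -> isomorphic B A.
Proof.
case=> alpha [beta [ab [alpha' aK a'K] [beta' bK b'K]]].
exists alpha', beta'; split; [|by exists alpha | by exists beta].
exact: embedding_inverse ab.
Qed.

(** * Transport of messages along an embedding *)

Section Embeddings.
Variables (A B : system) (alpha : state A -> state B) (beta : token A -> token B).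
Hypothesis emb : embedding alpha beta.

Let alpha_inj : injective alpha. Proof. by case: emb. Qed.

Lemma embedding_act1 S tau : val (beta tau) (alpha S) = alpha (val tau S).
Proof. by case: emb => _ _ _ _ ab; apply/ab. Qed.

Lemma embedding_act S m : act (alpha S) (map beta m) = alpha (act S m).
Proof. by elim: m S => //= tau m IHm S; rewrite -IHm embedding_act1. Qed.

Lemma embedding_stepwise_effective S m :
  stepwise_effective S m -> stepwise_effective (alpha S) (map beta m).
Proof.
elim: m S => [//|tau m IHm] S /stepwise_effective_cons[tauS eff].
apply/stepwise_effective_cons; rewrite embedding_act1; split; last exact: IHm.
by move/alpha_inj.
Qed.

(** The reverse condition is restricted to states in the range of [alpha]. Read contrapositively,
    this carries consistency from [m] to its image. *)
Lemma embedding_reverse sigma tau :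
  reverse (beta sigma) (beta tau) -> reverse sigma tau.
Proof.
case: emb => _ _ _ _ ab rev S T neq_ST.
by rewrite !ab; apply: rev => /alpha_inj.
Qed.

Lemma embedding_consistent m : consistent m -> consistent (map beta m).
Proof.
case: m => [|tau0 m]; first by move=> _ [].
move=> /(consistentP tau0) m_cons; apply/(consistentP (beta tau0)).
rewrite size_map => i j i_lt j_lt; rewrite !(nth_map tau0) //.
by move/embedding_reverse; apply: m_cons.
Qed.

(* Closes [tau'] by the image of a concise message from [T] back to [S]. *)
Lemma reverse_in_image (tau' : token B) S T : medium A -> medium B -> S <> T ->
  val tau' (alpha S) = alpha T ->
  exists2 rho : token A, val rho T = S &
    reverse tau' (beta rho) /\ reverse (beta rho) tau'.
Proof.
move=> [_ A_M1 _] [_ _ B_M2] neq_ST tau'S.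
have [|m [[m_eff m_cons _] m_act]] := A_M1 T S; first by move/esym.
have /vacuous_cons_consistent : vacuous (tau' :: map beta m).
  apply: B_M2; exists (alpha S); split.
    apply/stepwise_effective_cons; rewrite tau'S; split.
      by move/alpha_inj/esym.
    exact: embedding_stepwise_effective.
  by rewrite /= tau'S embedding_act m_act.
case/(_ (embedding_consistent m_cons)) => rho'.
(* The image of [m] has one letter, so [m] is a single token [rho], which takes [T] to [S]. *)
by case: m m_act {m_eff m_cons} => [|rho []] //= m_act [<-]; exists rho.
Qed.

Lemma token_in_image (tau' : token B) S T : medium A -> medium B -> S <> T ->
  val tau' (alpha S) = alpha T -> exists tau, val tau' = val (beta tau).
Proof.
move=> A_med B_med neq_ST tau'S.
have [rho rhoT [rev _]] := reverse_in_image A_med B_med neq_ST tau'S.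
have [||tau _ [_ rev']] := @reverse_in_image (beta rho) T S A_med B_med.
- by move/esym.
- by rewrite embedding_act1 rhoT.
exists tau; apply/funext => U.
(* Both [tau'] and [beta tau] have [beta rho] as reverse, so they agree wherever one of them moves
   [U]; a reverse says nothing about fixed states, hence the cases. *)
have [fix' | move'] := pselect (val tau' U = U).
  have [-> // | move_tau] := pselect (val (beta tau) U = U).
  have neq : U <> val (beta tau) U by move/esym.
  by apply/(rev _ _ neq)/(rev' _ _ neq).
have neq : U <> val tau' U by move/esym.
by apply/esym/(rev' _ _ neq)/(rev _ _ neq).
Qed.

(** * The isomorphism onto the reduction *)

Let Q := range alpha.

Let to_range (S : state A) : set_type Q := SigSub (mem_set (imageT alpha S)).

Let to_range_inj : injective to_range.
Proof. by move=> S T /(congr1 val)/alpha_inj. Qed.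

Let to_range_surj U : exists S, to_range S = U.
Proof.
have [S _ alphaS] := set_mem (valP U).
by exists S; apply: val_inj.
Qed.

(** The value lies in the range, so [insubd] does not fall back on its default. *)
Lemma reduce_image (tau' : state B -> state B) S T :
  tau' (alpha S) = alpha T -> reduce tau' (to_range S) = to_range T.
Proof.
move=> tau'S; apply: val_inj; rewrite /reduce val_insubd /= tau'S.
by rewrite mem_set //; exists T.
Qed.

(** This conjugation by [to_range] yields that reduced image tokens are not the identity, that
    [to_reduction] is injective, and the embedding condition. *)
Let reduce_beta tau S :
  reduce (val (beta tau)) (to_range S) = to_range (val tau S).
Proof. exact/reduce_image/embedding_act1. Qed.

Let reduction_token tau : tokens (reduction Q) (reduce (val (beta tau)) (Q := Q)).
Proof.
split; first by exists (val (beta tau)) => //; exact: set_mem (valP (beta tau)).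
have A_sys : token_system A by case: emb.
move=> red_id; apply: (token_neq_id A_sys (tau := tau)); apply/funext => S.
by apply: to_range_inj; rewrite -reduce_beta red_id.
Qed.

Let to_reduction tau : token (reduction Q) := SigSub (mem_set (reduction_token tau)).

Let to_reduction_inj : injective to_reduction.
Proof.
move=> sigma tau /(congr1 val) /= eq_red; apply: val_inj; apply/funext => S.
by apply: to_range_inj; rewrite -!reduce_beta eq_red.
Qed.

Let to_reduction_surj : medium A -> medium B ->
  forall sigma, exists tau, to_reduction tau = sigma.
Proof.
move=> A_med B_med sigma.
have [[tau' tau'_tok sigmaE] sigma_neq] := set_mem (valP sigma).
(* Otherwise each state of the range is fixed by [tau'] or sent outside the range, where the
   reduction fixes it by default; the reduction would be the identity. *)
have [S [T [neq_ST tau'S]]] : exists S T, S <> T /\ tau' (alpha S) = alpha T.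
  apply: contrapT => fix'; apply: sigma_neq; rewrite sigmaE.
  apply/funext => U; have [S <-] := to_range_surj U.
  apply: val_inj; rewrite /reduce val_insubd /=.
  case: ifP => // /set_mem[T _ alphaT].
  rewrite -alphaT; congr alpha; apply: contrapT => neq_TS.
  by apply: fix'; exists S, T; split=> // /esym.
have [tau tauE] := @token_in_image (SigSub (mem_set tau'_tok))
  S T A_med B_med neq_ST tau'S.
by exists tau; apply: val_inj; rewrite /= sigmaE -tauE.
Qed.

Lemma isomorphic_reduction_range : medium A -> medium B ->
  isomorphic A (reduction Q).
Proof.
move=> A_med B_med; exists to_range, to_reduction; split.
- have A_sys : token_system A by case: emb.
  split=> //.
    (* The reduction is a token system: its states and a token come from [A], and its definition
       excludes the identity. *)
    split; last by move=> sigma [].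
      have [[S [T neq_ST]] _ _] := A_sys.
      by exists (to_range S), (to_range T) => /to_range_inj.
    have [_ [tau tau_tok] _] := A_sys.
    exists (val (to_reduction (SigSub (mem_set tau_tok)))).
    exact: reduction_token.
  move=> S T tau; split=> [<- | red]; first exact: reduce_beta.
  by apply: to_range_inj; rewrite -reduce_beta; exact: red.
- exact: bijective_inj_surj.
- by apply: bijective_inj_surj => //; exact: to_reduction_surj.
Qed.

End Embeddings.

Theorem theorem11p1 (A B : system)
    (alpha : state A -> state B) (beta : token A -> token B) :
  medium A -> medium B -> embedding alpha beta ->
  isomorphic (reduction (range alpha)) A.
Proof.
move=> A_med B_med emb.
exact: isomorphic_sym (isomorphic_reduction_range emb A_med B_med).
Qed.
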